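(* Let $d\ge 2$ be an integer and let $\Lambda=\{\lambda_n\}_{n=1}^\infty$ be a sequence of real numbers with $1<\lambda_1\le\lambda_2\le\cdots$ and $\lim_{n\to\infty}\lambda_n=\infty$. Suppose that $$\frac{\lambda_n}{n}\downarrow 0\quad\text{and}\quad \sum_{n=1}^\infty\frac{\lambda_n\log^{d-2}n}{n^2}<\infty .$$ Then there exists a sequence $\Gamma=\{\gamma_n\}_{n=1}^\infty$ of positive numbers with $\gamma_n=o(n)$ as $n\to\infty$ such that $PBV_\Lambda\subset BV_\Gamma$ (as classes of functions of $d$ variables).
   Context: Here $\lambda_n/n\downarrow0$ means that the sequence is non-increasing and tends to $0$; $\log^{d-2}n=(\log n)^{d-2}$, understood as $1$ when $d=2$. Let $T=[0,2\pi]$, $D=\{1,\dots,d\}$. All functions $f$ are real-valued measurable functions on $\mathbb{R}^d$, $2\pi$-periodic in each variable. Mixed difference: for intervals $J^k=(a^k,b^k)\subset T$, put $f(J^1)=f(b^1)-f(a^1)$ if $d=1$, and inductively $f(J^1\times\cdots\times J^d)=f(J^1\times\cdots\times J^{d-1},b^d)-f(J^1\times\cdots\times J^{d-1},a^d)$. For nonempty $\alpha=\{j_1,\dots,j_p\}\subset D$ let $\widetilde\alpha=D\setminus\alpha$ and let $x^{\widetilde\alpha}$ be the vector of the coordinates $x^j$, $j\in\widetilde\alpha$; $f(I^1\times\cdots\times I^p,x^{\widetilde\alpha})$ denotes the mixed difference of $f$ as a function of the variables $x^{j_1},\dots,x^{j_p}$, the other variables being fixed equal to $x^{\widetilde\alpha}$.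 Let $\Omega$ be the set of all (arbitrarily ordered) finite collections of nonoverlapping intervals contained in $T$. For a sequence $\Lambda=\{\lambda_n\}$ of positive numbers and nonempty $\alpha\subset D$ with $p$ elements set $$V^{\alpha}_{\Lambda}(f)=\sup_{x^{\widetilde\alpha}\in T^{d-p}}\ \sup_{\{I^j_{i_j}\}_{i_j=1}^{k_j}\in\Omega,\ j=1,\dots,p}\ \sum_{i_1,\dots,i_p}\frac{|f(I^1_{i_1}\times\cdots\times I^p_{i_p},x^{\widetilde\alpha})|}{\lambda_{i_1}\cdots\lambda_{i_p}} .$$ $BV_\Lambda$ is the class of $f$ with $\sum_{\emptyset\ne\alpha\subset D}V^\alpha_\Lambda(f)<\infty$ (bounded total $\Lambda$-variation). $PBV_\Lambda$ is the class of $f$ with $\sum_{i=1}^dV^{\{i\}}_\Lambda(f)<\infty$ (bounded partial $\Lambda$-variation). *)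

(* Defs.v *)
From HB Require Import structures.
From mathcomp Require Import all_boot all_order all_algebra.
From mathcomp Require Import all_classical all_reals all_analysis.

Set Implicit Arguments.
Unset Strict Implicit.
Unset Printing Implicit Defensive.

Import Order.TTheory GRing.Theory Num.Theory.
Import numFieldNormedType.Exports.

Local Open Scope classical_set_scope.
Local Open Scope ring_scope.

Section LebesgueMeasurability.
Variables (R : realType) (d : nat).

Definition box (a b : 'rV[R]_d) : set 'rV[R]_d :=
  [set x | forall j, x 0 j \in `]a 0 j, b 0 j[].

Definition box_volume (a b : 'rV[R]_d) : R := \prod_j (b 0 j - a 0 j).

(* Lebesgue outer measure on R^d, d >= 1: covers by countably many open boxes,
   possibly empty. *)
Definition lebesgue_outer (A : set 'rV[R]_d) : \bar R :=
  ereal_inf [set (\sum_(0 <= k <oo) (box_volume (u k).1 (u k).2)%:E)%E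
            | u in [set u : nat -> 'rV[R]_d * 'rV[R]_d |
                     (forall k j, (u k).1 0 j <= (u k).2 0 j) /\
                     A `<=` \bigcup_k box (u k).1 (u k).2]].

Definition lebesgue_measurable_fun (f : 'rV[R]_d -> R) : Prop :=
  forall Y : set R, measurable Y -> lebesgue_outer.-caratheodory (f @^-1` Y).

End LebesgueMeasurability.

Section LambdaVariation.
Variables (R : realType) (d : nat).
Implicit Types (f : 'rV[R]_d -> R) (lam : nat -> R) (alpha : {set 'I_d}).

Definition periodic_fun f : Prop :=
  forall (x : 'rV[R]_d) (j : 'I_d), f (x + (2 * pi) *: delta_mx 0 j) = f x.

Definition base_class : set ('rV[R]_d -> R) :=
  [set f | lebesgue_measurable_fun f /\ periodic_fun f].

(* The interval (a, b) is encoded by the pair of its endpoints, and a finite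
   ordered collection of intervals by a sequence of pairs. *)
Definition interval_collection : set (seq (R * R)) :=
  [set s | (forall J, J \in s -> [/\ 0 <= J.1, J.1 < J.2 & J.2 <= 2 * pi]) /\
           trivIset [set i | (i < size s)%N]
             (fun i => `](nth (0, 0) s i).1, (nth (0, 0) s i).2[%classic)].

Definition set_coord (x : 'rV[R]_d) (j : 'I_d) (t : R) : 'rV[R]_d :=
  \row_k (if k == j then t else x 0 k).

Definition diff_coord f (j : 'I_d) (J : R * R) : 'rV[R]_d -> R :=
  fun x => f (set_coord x j J.2) - f (set_coord x j J.1).

(* With alpha = {j_1 < ... < j_p}, the k-th step of the fold takes the
   difference, in the variable j_k, of the mixed difference over j_1, ..., j_(k-1).
   The result does not depend on the coordinates of x lying in alpha. *)
Definition mixed_diff f alpha (J : {j : 'I_d | j \in alpha} -> R * R)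
    : 'rV[R]_d -> R :=
  foldl (fun g j => diff_coord g (val j) (J j)) f
    (enum {: {j : 'I_d | j \in alpha}}).

(* Sequences are indexed from 1: the value lam 0 is never used. The interval of
   index n of a collection, counting from 0, is weighted by lam n.+1. *)
Definition variation_sum lam alpha f
    (I : {j : 'I_d | j \in alpha} -> seq (R * R)) (x : 'rV[R]_d) : R :=
  \sum_(i : {dffun forall j : {j : 'I_d | j \in alpha}, 'I_(size (I j))})
    `|mixed_diff f (fun j => nth (0, 0) (I j) (i j)) x|
      / \prod_(j : {j : 'I_d | j \in alpha}) lam (i j).+1.

Definition variation lam alpha f : \bar R :=
  ereal_sup
    [set ereal_sup
      [set (variation_sum lam f I x)%:E
      | I in [set I : {j : 'I_d | j \in alpha} -> seq (R * R) |
               forall j, interval_collection (I j)]]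
    | x in [set x : 'rV[R]_d |
             forall j, j \in (~: alpha)%SET -> 0 <= x 0 j <= 2 * pi]].

Definition BV lam : set ('rV[R]_d -> R) :=
  [set f | base_class f /\
    (\sum_(alpha : {set 'I_d} | alpha != finset.set0) variation lam alpha f
      < +oo)%E].

Definition PBV lam : set ('rV[R]_d -> R) :=
  [set f | base_class f /\
    (\sum_(i < d) variation lam [set i]%SET f < +oo)%E].

End LambdaVariation.

Arguments BV {R} d lam.
Arguments PBV {R} d lam.

(* Main.v *)
(** Put gamma_n = n / omega_n with omega_n growing to infinity so slowly that
    lambda_n omega_n / n stays non-increasing and
    sum_n lambda_n (1 + 1/2 + ... + 1/n)^(d-2) omega_n^d / n^2 still converges.

    For a set alpha of p >= 2 variables, split the sum defining the variation according
    to the variable whose interval index is largest and the one whose index m is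
    largest among the rest. Summing over the largest index alone, with weights
    1/lambda, costs at most 2^p times the partial variation, because a mixed
    difference is a signed sum of one-dimensional differences; replacing
    1/gamma by 1/lambda there yields a factor lambda_m / gamma_m. The
    remaining weights add up to at most
    sum_m (lambda_m / gamma_m^2) (sum_(i <= m) 1/gamma_i)^(p-2), which is finite
    by the choice of omega. *)

Require Import Defs.
From HB Require Import structures.
From mathcomp Require Import all_boot all_order all_algebra.
From mathcomp Require Import all_classical all_reals all_analysis.
From mathcomp Require Import lra.

Set Implicit Arguments.
Unset Strict Implicit.
Unset Printing Implicit Defensive.

Import Order.TTheory GRing.Theory Num.Theory.
Import numFieldNormedType.Exports.

Local Open Scope classical_set_scope.
Local Open Scope ring_scope.

(** * Finite sums over families of indices *)

Lemma ler_sum_inj (R : realType) (I J : finType) (h : I -> J) (F : J -> R) :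
  injective h -> (forall j, 0 <= F j) -> \sum_i F (h i) <= \sum_j F j.
Proof.
move=> h_inj F0; rewrite -(big_imset F (A := predT) (in2W h_inj)).
by rewrite [leRHS](bigID [in h @: predT]) lerDl sumr_ge0.
Qed.

Lemma ler_sum_term (R : realType) (I : finType) (P : pred I) (F : I -> R) i :
  (forall j, P j -> 0 <= F j) -> P i -> F i <= \sum_(j | P j) F j.
Proof.
by move=> F0 Pi; rewrite (bigD1 i) //= lerDl sumr_ge0 // => j /andP[/F0].
Qed.

Definition ffun_upd (T : finType) (S : Type) (i : {ffun T -> S}) (t : T) (l : S)
  : {ffun T -> S} := [ffun t' => if t' == t then l else i t'].

Lemma ffun_updE (T : finType) (S : Type) (i : {ffun T -> S}) t l :
  ffun_upd i t l t = l.
Proof. by rewrite ffunE eqxx. Qed.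

Lemma ffun_upd_neq (T : finType) (S : Type) (i : {ffun T -> S}) t l t' :
  t' != t -> ffun_upd i t l t' = i t'.
Proof. by rewrite ffunE => /negbTE ->. Qed.

(* The involution (i, l) |-> (i with value l at t, i t) turns the sum over i into
   an average of sums along the lines parallel to the t-th axis. *)
Lemma sum_line_bound (R : realType) (T : finType) (N : nat)
    (a : {ffun T -> 'I_N.+1} -> R) (t : T) (w : T -> 'I_N.+1 -> R) (C : R) :
  (forall j l, 0 <= w j l) ->
  (forall i, \sum_l a (ffun_upd i t l) <= C) ->
  \sum_i a i * \prod_(j | j != t) w j (i j)
    <= C * \prod_(j | j != t) \sum_l w j l.
Proof.
move=> w0 aC.
pose W (i : {ffun T -> 'I_N.+1}) := \prod_(j | j != t) w j (i j).
have W0 i : 0 <= W i by apply: prodr_ge0.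
have Wupd i l : W (ffun_upd i t l) = W i.
  by apply: eq_bigr => j jt; rewrite ffun_upd_neq.
(* [W] ignores the coordinate [t]; giving it weight 1 in [w'] completes the product, and the free
   coordinate accounts for the factor [N.+1]. *)
have sumW : \sum_i W i = N.+1%:R * \prod_(j | j != t) \sum_l w j l.
  pose w' j l := if j == t then 1 else w j l.
  transitivity (\sum_i \prod_j w' j ((i : {ffun T -> 'I_N.+1}) j)).
    apply: eq_bigr => i _; rewrite [RHS](bigD1 t) //= /w' eqxx mul1r.
    by apply: eq_bigr => j /negbTE ->.
  rewrite -(bigA_distr_bigA w') (bigD1 t) //= /w' eqxx; congr (_ * _).
    by rewrite sumr_const card_ord.
  by apply: eq_bigr => j /negbTE ->.
have swapK : involutive (fun p : {ffun T -> 'I_N.+1} * 'I_N.+1 =>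
    (ffun_upd p.1 t p.2, p.1 t)).
  move=> [i l] /=; rewrite ffun_updE; congr pair.
  by apply/ffunP => j; rewrite !ffunE; case: eqP => [->|].
rewrite -(ler_pM2l (ltr0Sn R N)) mulrCA -sumW mulr_sumr.
have -> : \sum_i N.+1%:R * (a i * W i) = \sum_i \sum_l a (ffun_upd i t l) * W i.
  transitivity (\sum_i \sum_(l < N.+1) a i * W i).
    by apply: eq_bigr => i _; rewrite sumr_const card_ord mulr_natl.
  rewrite !pair_bigA /= (reindex_inj (inv_inj swapK)) /=.
  by apply: eq_bigr => p _; rewrite Wupd.
rewrite mulr_sumr; apply: ler_sum => i _.
by rewrite -mulr_suml ler_wpM2r.
Qed.

(** Here [l] and [g] stand for the shifted lambda and gamma. Each term is charged to a pair of
    variables ([t0], [t1]) carrying the largest index and the largest among the others, whence at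
    most [#|T| ^ 2] pairs. At [t0], [1/g] is traded for [th k / l], with [k] the index at [t1], and
    the sum along [t0] is bounded by [C]. *)
Lemma sum_over_max_pair (R : realType) (T : finType) (N : nat)
    (l g th : nat -> R) (a : {ffun T -> 'I_N.+1} -> R) (C K : R) :
  (1 < #|T|)%N ->
  (forall n, 0 < l n) -> (forall n, 0 < g n) -> (forall n, 0 <= th n) ->
  (forall k n, (k <= n)%N -> l n <= th k * g n) ->
  (forall i, 0 <= a i) -> 0 <= C ->
  (forall t i, \sum_(k < N.+1) a (ffun_upd i t k) / l k <= C) ->
  (\sum_(k < N.+1) th k / g k * (\sum_(m < k.+1) (g m)^-1) ^+ (#|T| - 2) <= K) ->
  \sum_i a i / \prod_t g (i t) <= #|T|%:R ^+ 2 * (C * K).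
Proof.
move=> T1 l0 g0 th0 lthg a0 C0 aC sumK.
(* The indicators force the index at [t1] to be [k] and the other indices to be at most [k]. The
   factor [th k] coming from the exchange at [t0] is stored in the weight at [t1]. *)
pose w (t1 : T) (k : 'I_N.+1) (j : T) (m : 'I_N.+1) : R :=
  if j == t1 then (m == k)%:R * (th k / g k) else (m <= k)%:R / g m.
have w0 t1 k j m : 0 <= w t1 k j m.
  rewrite /w; case: ifP => _; rewrite mulr_ge0 ?ler0n ?invr_ge0 ?(ltW (g0 _)) //.
  by rewrite divr_ge0 // ltW.
pose F t0 t1 k (i : {ffun T -> 'I_N.+1}) :=
  a i / l (i t0) * \prod_(j | j != t0) w t1 k j (i j).
have F0 t0 t1 k i : 0 <= F t0 t1 k i.
  by rewrite mulr_ge0 ?prodr_ge0 // divr_ge0 // ltW.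
(* All terms on the right are nonnegative, so it suffices to exhibit one that dominates: [t0] and
   [t1] are the two maximizers and [k = i t1]. Ties only overcount. *)
have pointwise i : a i / \prod_t g (i t) <=
    \sum_t0 \sum_(t1 | t1 != t0) \sum_k F t0 t1 k i.
  have [s _] : exists s : T, true by case/card_gt0P: (ltnW T1) => s; exists s.
  case: (@arg_maxnP T s predT (fun t => i t : nat) isT) => t0 _ t0max.
  have [s' s't0] : exists s', s' != t0.
    have /card_gt0P[s'] : (0 < #|predC1 t0|)%N by rewrite cardC1 -subn1 subn_gt0.
    by rewrite inE; exists s'.
  case: (@arg_maxnP T s' (fun t => t != t0) (fun t => i t : nat) s't0) => t1 t10 t1max.
  have F1 t t' : 0 <= \sum_k F t t' k i by rewrite sumr_ge0.
  apply: le_trans (ler_sum_term (i := t0) _ isT) => [|t _]; last first.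
    by rewrite sumr_ge0.
  apply: le_trans (ler_sum_term (i := t1) _ t10) => [|t _ //].
  apply: le_trans (ler_sum_term (i := i t1) _ isT) => [|//].
  rewrite /F -mulrA ler_wpM2l //.
  rewrite (bigD1 t0) //= (bigD1 t1) //= [in leRHS](bigD1 t1) //= /w !eqxx mul1r.
  have -> : \prod_(j | (j != t0) && (j != t1))
      (if j == t1 then (i j == i t1)%:R * (th (i t1) / g (i t1))
       else (i j <= i t1)%:R / g (i j))
    = (\prod_(j | (j != t0) && (j != t1)) g (i j))^-1.
    rewrite -prodfV; apply: eq_bigr => j /andP[jt0 /negbTE ->].
    by have /= -> := t1max j jt0; rewrite mul1r.
  rewrite !invfM !mulrA ler_wpM2r ?invr_ge0 ?prodr_ge0 // => [*|].
    exact: ltW.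
  rewrite ler_wpM2r ?invr_ge0 ?(ltW (g0 _)) //.
  rewrite [leRHS]mulrC ler_pdivlMr // mulrC ler_pdivrMr //.
  by apply: lthg; exact: (t0max t1).
apply: (le_trans (ler_sum _ (fun i _ => pointwise i))).
have card_mul x : #|T|%:R * x = \sum_(t : T) x :> R.
  by rewrite sumr_const mulr_natl.
rewrite exchange_big /= expr2 -mulrA card_mul.
apply: ler_sum => t0 _; rewrite exchange_big /= card_mul.
rewrite [leRHS](bigID (fun t1 => t1 != t0)) /=.
have K0 : 0 <= K.
  apply: le_trans sumK; apply: sumr_ge0 => k _.
  rewrite mulr_ge0 ?divr_ge0 ?(ltW (g0 _)) // exprn_ge0 // sumr_ge0 // => m _.
  by rewrite invr_ge0 ltW.
rewrite ler_wpDr ?sumr_ge0 // => [*|]; first by rewrite mulr_ge0.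
apply: ler_sum => t1 t10; rewrite exchange_big /=.
apply: le_trans (ler_wpM2l C0 sumK); rewrite mulr_sumr; apply: ler_sum => k _.
have line := @sum_line_bound R T N (fun i => a i / l (i t0)) t0 (w t1 k) C (w0 t1 k).
apply: le_trans (line _) _ => [i|].
  by under eq_bigr do rewrite ffun_updE; exact: aC.
(* The sum at [t1] collapses to [th k / g k]; each of the [#|T| - 2] remaining variables contributes
   the sum of [1 / g m] over [m <= k]. *)
rewrite ler_wpM2l // (bigD1 t1) //= {1}/w eqxx -mulr_suml.
rewrite (bigD1 k) //= eqxx big1 ?addr0 ?mul1r => [|m /negbTE ->//].
rewrite le_eqVlt; apply/orP; left; apply/eqP; congr (_ * _).
transitivity (\prod_(j | (j != t0) && (j != t1)) \sum_(m < k.+1) (g m)^-1).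
  apply: eq_bigr => j /andP[_ jt1]; rewrite /w (negbTE jt1).
  rewrite (big_ord_widen_cond N.+1 predT (fun m => (g m)^-1)) //= [RHS]big_mkcond /=.
  by apply: eq_bigr => m _; rewrite ltnS; case: (m <= k)%N; rewrite ?mul1r ?mul0r.
rewrite prodr_const; congr (_ ^+ _).
have -> : #|fun j => (j != t0) && (j != t1)| = #|predD1 (predC1 t0) t1|.
  by apply: eq_card => j; rewrite !inE andbC.
have := cardC1 t0; rewrite (cardD1 t1 (predC1 t0)) inE t10 add1n.
by rewrite subn2 => <-.
Qed.

(** * Mixed differences along one variable *)

Section MixedDifferences.
Variables (R : realType) (d : nat).
Implicit Types (f g : 'rV[R]_d -> R) (x y : 'rV[R]_d) (J K : R * R).

Lemma diff_coordC f (j k : 'I_d) J K : j != k ->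
  diff_coord (diff_coord f j J) k K = diff_coord (diff_coord f k K) j J.
Proof.
move=> jk; apply/funext => x; rewrite /diff_coord.
have swap s t : set_coord (set_coord x k s) j t = set_coord (set_coord x j t) k s.
  apply/rowP => i; rewrite !mxE.
  by case: eqP => [->|_] //; rewrite (negbTE jk).
by rewrite !swap; lra.
Qed.

(** Allows the difference in a chosen variable to be taken first, whatever its place in the
    enumeration of [alpha]. *)
Lemma foldl_commute_rem (T : eqType) (S : Type) (step : S -> T -> S) :
  (forall z t t', step (step z t) t' = step (step z t') t) ->
  forall t s z, t \in s -> foldl step z s = foldl step (step z t) (rem t s).
Proof.
move=> stepC t; elim=> [//|a s IH] z; rewrite inE /=.
rewrite [a == t]eq_sym; case: eqVneq => [->|_] //= ts.
by rewrite IH // stepC.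
Qed.

Definition in_period (u : R) := 0 <= u <= 2 * pi.

(* A is the set of coordinates on which the g l do not depend, so that y need not
   be constrained there. *)
Lemma foldl_diff_sum (alpha : {set 'I_d}) (N : nat) (w : 'I_N -> R) :
  (forall l, 0 <= w l) ->
  forall (s : seq {j | j \in alpha}) (A : pred 'I_d) (J : {j | j \in alpha} -> R * R)
    (g : 'I_N -> 'rV[R]_d -> R) (C : R),
  (forall t, in_period (J t).1 /\ in_period (J t).2) ->
  (forall y, (forall k, ~~ A k -> in_period (y 0 k)) -> \sum_l `|g l y| * w l <= C) ->
  forall y, (forall k, ~~ A k -> k \notin map val s -> in_period (y 0 k)) ->
  \sum_l `|foldl (fun h j => diff_coord h (val j) (J j)) (g l) s y| * w l
    <= 2 ^+ size s * C.
Proof.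
move=> w0; elim=> [|t s IH] A J g C Jper gC y yper /=.
  by rewrite expr0 mul1r; apply: gC => k Ak; exact: yper.
rewrite exprSr -mulrA.
(* The first difference overwrites the coordinate [val t] by endpoints of [J t], so this coordinate
   joins [A], and the bound [C] becomes [2 * C]. *)
apply: (IH (fun k => (k == val t) || A k)) => // [{}y {}yper|k]; last first.
  rewrite negb_or => /andP[kt Ak] ks; apply: yper => //.
  by rewrite inE negb_or kt.
have [J1 J2] := Jper t.
have upd v : in_period v -> forall k, ~~ A k -> in_period (set_coord y (val t) v 0 k).
  by move=> vper k Ak; rewrite mxE; case: eqP => // kt; apply: yper; case: eqP kt.
rewrite mulr_natl mulr2n.
apply: le_trans (lerD (gC _ (upd _ J2)) (gC _ (upd _ J1))).
rewrite -big_split /=; apply: ler_sum => l _.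
by rewrite -mulrDl ler_wpM2r // ler_normB.
Qed.

(** Differences in distinct variables commute, so the one in [t] comes first and is controlled by
    [C]. The others use intervals independent of [l], and each at most doubles the bound; their
    number is rounded up to [#|alpha|]. *)
Lemma mixed_diff_line (alpha : {set 'I_d}) (N : nat) (w : 'I_N -> R) f
    (J : 'I_N -> {j | j \in alpha} -> R * R) (J0 : {j | j \in alpha} -> R * R)
    (t : {j | j \in alpha}) (C : R) :
  (forall l, 0 <= w l) ->
  (forall t', in_period (J0 t').1 /\ in_period (J0 t').2) ->
  (forall l t', t' != t -> J l t' = J0 t') ->
  (forall y, (forall k, k != val t -> in_period (y 0 k)) ->
     \sum_l `|diff_coord f (val t) (J l t) y| * w l <= C) ->
  forall y, (forall k, k \notin alpha -> in_period (y 0 k)) ->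
  \sum_l `|mixed_diff f (J l) y| * w l <= 2 ^+ #|alpha| * C.
Proof.
move=> w0 J0per JJ0 fC y yper.
have C0 : 0 <= C.
  apply: le_trans (fC 0 _) => [|k _]; first by rewrite sumr_ge0 // => l _; rewrite mulr_ge0.
  by rewrite /in_period mxE lexx mulr_ge0 ?pi_ge0.
set s := enum {: {j | j \in alpha}}.
have uniq_s : uniq s by rewrite enum_uniq.
have ts : t \in s by rewrite mem_enum.
have E l : mixed_diff f (J l) = foldl (fun h j => diff_coord h (val j) (J0 j))
    (diff_coord f (val t) (J l t)) (rem t s).
  rewrite /mixed_diff (foldl_commute_rem _ _ ts) => [|z t1 t2]; last first.
    have [->//|t12] := eqVneq t1 t2; exact: diff_coordC.
  have : t \notin rem t s by rewrite mem_rem_uniqF.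
  elim: (rem t s) (diff_coord _ _ _) => //= a r IH z.
  by rewrite inE negb_or eq_sym => /andP[a_t /IH ->]; rewrite JJ0.
under eq_bigr do rewrite E.
apply: le_trans (@foldl_diff_sum _ _ w w0 (rem t s) (pred1 (val t)) J0 _ C J0per _ y _) _.
- by move=> z zper; apply: fC.
- move=> k kt krem; apply: yper; apply: contra krem => k_alpha.
  apply/mapP; exists (exist _ k k_alpha) => //.
  rewrite mem_rem_uniq // inE /= mem_enum andbT; apply: contra kt => /eqP <- /=.
  exact: eqxx.
rewrite ler_wpM2r // ler_weXn2l // ?ler1n // size_rem //.
by rewrite (leq_trans (leq_pred _)) // -cardE card_sig.
Qed.

End MixedDifferences.

(** * Weights growing to infinity that preserve summability *)

Section SlowlyGrowingWeights.
Variable R : realType.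
Implicit Types (u A a om : nat -> R).

(** With [T n] the tail of the series from [n], the choice [a n ^+ d = sqrt (T 0 / T n)] works: the
    tails decrease to 0, so [a] grows to infinity, while [u n / sqrt (T n)] is dominated by a
    telescoping difference. *)
Lemma summable_weight u (d : nat) (B : R) : (0 < d)%N ->
  (forall n, 0 < u n) -> (forall n, \sum_(k < n) u k <= B) ->
  exists a, [/\ forall n, 1 <= a n, forall n, a n <= a n.+1,
    forall L, exists N, forall n, (N <= n)%N -> L <= a n &
    exists K, forall n, \sum_(k < n) u k * a k ^+ d <= K].
Proof.
move=> d0 u0 uB.
pose S n := \sum_(k < n) u k.
have SE n : S n.+1 = S n + u n by rewrite /S big_ord_recr.
have Smono : {homo S : n m / (n <= m)%N >-> n <= m}.
  by apply/nondecreasing_seqP => n; rewrite SE lerDl ltW.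
have Scvg : cvgn S.
  by apply: nondecreasing_is_cvgn => //; exists B => _ [n _ <-]; exact: uB.
pose T n := limn S - S n.
have TE n : T n = T n.+1 + u n by rewrite /T SE; lra.
have T0 n : 0 < T n.
  by rewrite TE ltr_wpDl // /T subr_ge0; exact: nondecreasing_cvgn_le.
have Tmono n : T n.+1 <= T n by rewrite [leRHS]TE lerDl ltW.
have T0n n : T n <= T 0%N by elim: n => // n; exact: le_trans.
have Tsmall e : 0 < e -> exists N, forall n, (N <= n)%N -> T n <= e.
  move=> e0; move/cvgrPdist_le : Scvg => /(_ e e0) [N _ NS].
  by exists N => n /NS /=; rewrite ger0_norm // ltW // T0.
pose b n := Num.sqrt (T 0%N / T n).
have b1 n : 1 <= b n.
  by rewrite -[leLHS]sqrtr1 ler_wsqrtr // ler_pdivlMr ?mul1r.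
have bmono n : b n <= b n.+1.
  by rewrite ler_wsqrtr // ler_pM2l // lef_pV2 ?posrE.
have b0 n : 0 <= b n by apply: le_trans (b1 n).
exists (fun n => b n `^ d%:R^-1).
have aX n : (b n `^ d%:R^-1) ^+ d = b n.
  by rewrite -powR_mulrn ?powR_ge0 // -powRrM mulVf ?pnatr_eq0 -?lt0n // powRr1.
have ageL L n : 0 <= L -> L ^+ d <= b n -> L <= b n `^ d%:R^-1.
  by move=> L0; rewrite -[in X in X -> _]aX ler_pXn2r ?nnegrE ?powR_ge0.
split=> [n|n|L|].
- by apply: ageL; rewrite ?expr1n.
- by rewrite ageL ?powR_ge0 // aX.
- have L1 : 0 < 1 + `|L| by rewrite ltr_pwDl.
  (* This threshold gives [b n >= (1 + |L|) ^ d]: the square root halves the exponent [d * 2]. *)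
  have [N NT] := Tsmall (T 0%N / (1 + `|L|) ^+ (d * 2))
    (divr_gt0 (T0 _) (exprn_gt0 _ L1)).
  exists N => n /NT Tn; apply: le_trans (_ : 1 + `|L| <= _).
    by rewrite ler_wpDl // ler_norm.
  apply: ageL; first exact: ltW.
  rewrite -[leLHS]ger0_norm ?exprn_ge0 ?(ltW L1) // -sqrtr_sqr ler_wsqrtr //.
  by rewrite -exprM ler_pdivlMr // mulrC -ler_pdivlMr ?exprn_gt0.
- exists (2 * T 0%N) => n.
  have : \sum_(k < n) u k * (b k `^ d%:R^-1) ^+ d <=
      2 * Num.sqrt (T 0%N) * (Num.sqrt (T 0%N) - Num.sqrt (T n)).
    elim: n => [|n IH]; first by rewrite big_ord0 subrr mulr0.
    rewrite big_ord_recr /= aX.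
    (* With [x = sqrt (T n)] and [y = sqrt (T n.+1)], this is [x^2 - y^2 <= 2 x (x - y)], valid
       since [0 <= y <= x]. *)
    have : u n * b n <= 2 * Num.sqrt (T 0%N) * (Num.sqrt (T n) - Num.sqrt (T n.+1)).
      rewrite /b sqrtrM ?(ltW (T0 _)) // mulrCA -mulrA [2 * _]mulrCA ler_wpM2l //.
      rewrite sqrtrV ?(ltW (T0 _)) // ler_pdivrMr ?sqrtr_gt0 //.
      have -> : u n = Num.sqrt (T n) ^+ 2 - Num.sqrt (T n.+1) ^+ 2.
        by rewrite !sqr_sqrtr ?(ltW (T0 _)) // TE; lra.
      have := sqrtr_ge0 (T n.+1); have : Num.sqrt (T n.+1) <= Num.sqrt (T n) by rewrite ler_wsqrtr.
      nra.
    by lra.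
  move=> /le_trans; apply.
  rewrite mulrBr -mulrA -expr2 sqr_sqrtr ?(ltW (T0 _)) // gerBl.
  by rewrite !mulr_ge0.
Qed.

(* The recursion for om keeps om <= a while never letting om grow faster than
   A decays. *)
Lemma regular_weight A u (d : nat) (B : R) : (0 < d)%N ->
  (forall n, 0 < A n) -> (forall n, A n.+1 <= A n) -> (A n @[n --> \oo] --> (0 : R)) ->
  (forall n, 0 < u n) -> (forall n, \sum_(k < n) u k <= B) ->
  exists om, [/\ forall n, 1 <= om n, forall n, om n <= om n.+1,
    forall L, exists N, forall n, (N <= n)%N -> L <= om n,
    forall n, A n.+1 * om n.+1 <= A n * om n &
    exists K, forall n, \sum_(k < n) u k * om k ^+ d <= K].
Proof.
move=> d0 A0 Amono Acvg u0 uB.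
have [a [a1 amono ainf [K aK]]] := summable_weight d0 u0 uB.
pose om := fix om n := if n is m.+1 then Num.min (a m.+1) (om m * A m / A m.+1) else a 0%N.
have omS n : om n.+1 = Num.min (a n.+1) (om n * A n / A n.+1) by [].
have oma n : om n <= a n by case: n => [|n] //; rewrite omS ge_min lexx.
have om1 n : 1 <= om n.
  elim: n => [|n IH] /=; first exact: a1.
  rewrite le_min a1 ler_pdivlMr // mul1r (le_trans (Amono n)) //.
  by rewrite ler_peMl // ltW.
have om0 n : 0 <= om n by apply: le_trans (om1 n).
have ommono n : om n <= om n.+1.
  rewrite omS le_min (le_trans (oma n)) //= ler_pdivlMr // ler_wpM2l //.
have Aom n : A n.+1 * om n.+1 <= A n * om n.
  by rewrite omS mulrC -ler_pdivlMr // ge_min [A n * _]mulrC lexx orbT.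
exists om; split=> // [L|]; last first.
  exists K => n; apply: le_trans (aK n); apply: ler_sum => k _.
  by rewrite ler_wpM2l ?(ltW (u0 _)) // lerXn2r ?nnegrE // (le_trans (om0 k)).
have [N NL] := ainf `|L|.
(* Once [a] exceeds [|L|], [om] can stay below [|L|] only while [A * om] keeps its value at [N];
   this cannot last, because [A] tends to 0. *)
have om_min n : Num.min `|L| (om N * A N / A (N + n)%N) <= om (N + n)%N.
  elim: n => [|n IH].
    by rewrite addn0 mulfK ?gt_eqF // ge_min lexx orbT.
  rewrite addnS omS le_min; apply/andP; split.
    by rewrite ge_min NL // leqW // leq_addr.
  rewrite ler_pdivlMr // minr_pMl ?(ltW (A0 _)) // divfK ?gt_eqF //.
  have : Num.min `|L| (om N * A N / A (N + n)%N) * A (N + n)%N <= om (N + n)%N * A (N + n)%N.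
    by rewrite ler_wpM2r // ltW.
  apply: le_trans; rewrite minr_pMl ?(ltW (A0 _)) // divfK ?gt_eqF //.
  rewrite le_min ge_min [X in _ && X]ge_min lexx orbT andbT.
  by rewrite ler_wpM2l.
have e0 : 0 < om N * A N / (1 + `|L|).
  by rewrite divr_gt0 ?mulr_gt0 ?ltr_pwDl // (lt_le_trans ltr01).
move/cvgrPdist_le : Acvg => /(_ _ e0) [N' _ N'A].
exists (N + N')%N => n Nn.
have := om_min (n - N)%N; rewrite subnKC ?(leq_trans (leq_addr _ _) Nn) //.
apply: le_trans; rewrite le_min ler_norm /= ler_pdivlMr //.
have /N'A /= : (N' <= n)%N by apply: leq_trans Nn; rewrite leq_addl.
rewrite sub0r normrN gtr0_norm // ler_pdivlMr ?ltr_pwDl //.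
apply: le_trans; rewrite mulrC ler_wpM2l ?(ltW (A0 _)) //.
by rewrite ler_wpDl // ler_norm.
Qed.

End SlowlyGrowingWeights.

(** * Bounds between variations *)

Section Variation.
Variables (R : realType) (d : nat).
Implicit Types (f : 'rV[R]_d -> R) (lam : nat -> R) (alpha : {set 'I_d}).

Lemma lambda_variation_ge_sum lam alpha f I (x : 'rV[R]_d) :
  (forall j, interval_collection (I j)) ->
  (forall j, j \notin alpha -> in_period (x 0 j)) ->
  ((@variation_sum R d lam alpha f I x)%:E <= Defs.variation lam alpha f)%E.
Proof.
move=> I_coll xper; apply: le_trans (ereal_sup_ubound _); last first.
  by exists x => // j; rewrite finset.in_setC => /xper.
by apply: ereal_sup_ubound; exists I.
Qed.

Lemma lambda_variation_le lam alpha f (C : R) :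
  (forall I (x : 'rV[R]_d), (forall j, interval_collection (I j)) ->
    (forall j, j \notin alpha -> in_period (x 0 j)) ->
    @variation_sum R d lam alpha f I x <= C) ->
  (Defs.variation lam alpha f <= C%:E)%E.
Proof.
move=> sumC; apply: ge_ereal_sup => _ [x xper <-].
apply: ge_ereal_sup => _ [I I_coll <-]; rewrite lee_fin; apply: sumC => // j ja.
by apply: xper; rewrite finset.in_setC.
Qed.

Lemma lambda_variation_ge0 lam alpha f : (forall n, 0 < lam n.+1) ->
  (0 <= Defs.variation lam alpha f)%E.
Proof.
move=> lam0; apply: le_trans (@lambda_variation_ge_sum _ _ _ (fun=> [::]) 0 _ _).
- by rewrite lee_fin sumr_ge0 // => i _; rewrite divr_ge0 ?prodr_ge0 // => *; exact: ltW.
- by move=> j; split=> //; rewrite set_nil; apply: trivIset_set0.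
- by move=> j _; rewrite /in_period mxE lexx mulr_ge0 ?pi_ge0.
Qed.

Lemma nth_interval_period s n : interval_collection s ->
  in_period (nth (0, 0) s n).1 /\ in_period (nth (0, 0) s n : R * R).2.
Proof.
have p0 : 0 <= pi :> R by exact: pi_ge0.
move=> [s_in _]; rewrite /in_period; have [ns|ns] := ltnP n (size s); last first.
  by rewrite nth_default //= lexx mulr_ge0.
have [J1 J2 J3] := s_in _ (mem_nth (0, 0) ns).
by rewrite J1 J3 (le_trans J1 (ltW J2)) (le_trans (ltW J2) J3).
Qed.

Lemma enum_set1_sig (j : 'I_d) (t : {k | k \in [set j]%SET}) :
  enum {: {k | k \in [set j]%SET}} = [:: t].
Proof.
have : size (enum {: {k | k \in [set j]%SET}}) = 1%N.
  by rewrite -cardE card_sig; exact: cards1.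
case: (enum _) => [|t' [|]] // _; congr cons; apply/val_inj.
by have /set1P -> := valP t'; have /set1P -> := valP t.
Qed.

(** [N] need not be the length of [s]: past the end, [nth] returns the degenerate pair [(0, 0)],
    whose difference vanishes. This permits a common index range for all variables. *)
Lemma lambda_variation_set1_ge lam (j : 'I_d) f (C : R) (s : seq (R * R)) (N : nat)
    (y : 'rV[R]_d) :
  (forall n, 0 < lam n.+1) -> (Defs.variation lam [set j]%SET f <= C%:E)%E ->
  interval_collection s -> (forall k, k != j -> in_period (y 0 k)) ->
  \sum_(l < N) `|diff_coord f j (nth (0, 0) s l) y| / lam l.+1 <= C.
Proof.
move=> lam0 VC s_coll yper.
pose F l := `|diff_coord f j (nth (0, 0) s l) y| / lam l.+1.
have F0 l : 0 <= F l by rewrite divr_ge0 // ltW.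
have Fsize l : (size s <= l)%N -> F l = 0.
  by move=> sl; rewrite /F nth_default // /diff_coord subrr normr0 mul0r.
apply: (@le_trans _ _ (\sum_(l < size s) F l)).
  rewrite -!(big_mkord predT F).
  apply: (@le_trans _ _ (\sum_(0 <= l < N + size s) F l)).
    by rewrite [leRHS](big_cat_nat (n := N)) ?leq_addr //= lerDl sumr_ge0.
  rewrite (big_cat_nat (n := size s)) ?leq_addl //= gerDl big_nat_cond big1 //.
  by move=> l /andP[/andP[/Fsize]].
rewrite -lee_fin; apply: le_trans VC; pose I (t : {k | k \in [set j]%SET}) := s.
apply: le_trans (@lambda_variation_ge_sum lam [set j]%SET f I y (fun=> s_coll) _); last first.
  by move=> k; rewrite inE; exact: yper.
rewrite lee_fin; pose t0 := exist (fun k => k \in [set j]%SET) j (set11 j).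
pose h (l : 'I_(size s)) : {dffun forall t : {k | k \in [set j]%SET}, 'I_(size (I t))}
  := [ffun t => l].
have h_inj : injective h by move=> l l' /ffunP /(_ t0); rewrite !ffunE.
apply: le_trans (ler_sum_inj h_inj _) => [|i]; last first.
  by rewrite divr_ge0 ?prodr_ge0 // => *; exact: ltW.
apply: ler_sum => l _; rewrite /F le_eqVlt; apply/orP; left; apply/eqP.
congr (`|_| / _); last by rewrite -big_enum /= (enum_set1_sig t0) big_seq1 ffunE.
by rewrite /mixed_diff (enum_set1_sig t0) /= ffunE.
Qed.

(** Serves for one-element [alpha], where there is no second largest index. *)
Lemma lambda_variation_rescale lam gam alpha f (C c : R) :
  (forall n, 0 < lam n.+1) -> (forall n, 0 < gam n.+1) -> 0 <= c ->
  (forall n, lam n.+1 <= c * gam n.+1) ->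
  (Defs.variation lam alpha f <= C%:E)%E ->
  (Defs.variation gam alpha f <= (c ^+ #|alpha| * C)%:E)%E.
Proof.
move=> lam0 gam0 c0 lamgam VC; apply: lambda_variation_le => I x I_coll xper.
have : variation_sum lam f I x <= C.
  by rewrite -lee_fin; apply: le_trans VC; exact: lambda_variation_ge_sum.
move=> /(ler_wpM2l (exprn_ge0 #|alpha| c0)); apply: le_trans.
rewrite mulr_sumr; apply: ler_sum => i _; rewrite mulrCA ler_wpM2l //.
rewrite -!prodfV.
have -> : c ^+ #|alpha| = \prod_(t : {k | k \in alpha}) c.
  by rewrite prodr_const card_sig.
rewrite -big_split /=; apply: ler_prod => t _.
rewrite invr_ge0 (ltW (gam0 _)) /= ler_pdivlMr // mulrC ler_pdivrMr //.
Qed.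

(** The collections may differ in length, so the index families are embedded by [h] into functions
    with values in one ['I_N.+1]; the terms added are nonnegative. Then [sum_over_max_pair] applies,
    with line sums bounded by [mixed_diff_line]. *)
Lemma lambda_variation_bound lam gam (th : nat -> R) alpha f (C K : R) :
  (1 < #|alpha|)%N ->
  (forall n, 0 < lam n.+1) -> (forall n, 0 < gam n.+1) -> (forall n, 0 <= th n) ->
  (forall k n, (k <= n)%N -> lam n.+1 <= th k * gam n.+1) ->
  0 <= C -> (forall j, (Defs.variation lam [set j]%SET f <= C%:E)%E) ->
  (forall n, \sum_(k < n) th k / gam k.+1 *
     (\sum_(m < k.+1) (gam m.+1)^-1) ^+ (#|alpha| - 2) <= K) ->
  (Defs.variation gam alpha f <= (#|alpha|%:R ^+ 2 * (2 ^+ #|alpha| * C * K))%:E)%E.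
Proof.
move=> alpha1 lam0 gam0 th0 thlam C0 VC sumK.
apply: lambda_variation_le => I x I_coll xper.
pose T := {k | k \in alpha}.
have cardT : #|{: T}| = #|alpha| by rewrite card_sig.
pose N := \max_(t : T) size (I t).
pose a (i : {ffun T -> 'I_N.+1}) := `|mixed_diff f (fun t => nth (0, 0) (I t) (i t)) x|.
pose h (i : {dffun forall t : T, 'I_(size (I t))}) : {ffun T -> 'I_N.+1} :=
  [ffun t => inord (i t)].
have hE i t : h i t = i t :> nat.
  by rewrite ffunE inordK // ltnW // ltnS (leq_trans (ltn_ord _)) // (leq_bigmax t).
have h_inj : injective h.
  by move=> i i' hii; apply/ffunP => t; apply/val_inj; rewrite /= -!hE hii.
have -> : variation_sum gam f I x = \sum_i a (h i) / \prod_t gam (h i t).+1.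
  apply: eq_bigr => i _; congr (`|mixed_diff _ _ _| / _).
    by apply/funext => t; rewrite hE.
  by apply: eq_bigr => t _; rewrite hE.
apply: le_trans (ler_sum_inj (F := fun i => a i / \prod_t gam (i t).+1) h_inj _) _.
  by move=> i; rewrite divr_ge0 ?normr_ge0 ?prodr_ge0 // => *; exact: ltW.
rewrite -[in X in X%:R ^+ 2]cardT.
apply: (@sum_over_max_pair R T N (fun n => lam n.+1) (fun n => gam n.+1) th) => //.
- by rewrite cardT.
- by move=> i; exact: normr_ge0.
- by rewrite mulr_ge0 // exprn_ge0.
- move=> t i.
  apply: (@mixed_diff_line R d alpha N.+1 (fun k => (lam k.+1)^-1) f
    (fun k t' => nth (0, 0) (I t') (ffun_upd i t k t'))
    (fun t' => nth (0, 0) (I t') (i t')) t C) => //.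
  + by move=> k; rewrite invr_ge0 ltW.
  + by move=> t'; apply: nth_interval_period.
  + by move=> k t' t't; rewrite ffun_upd_neq.
  + move=> y yper; under eq_bigr do rewrite ffun_updE.
    exact: lambda_variation_set1_ge.
- by rewrite cardT; exact: sumK.
Qed.

End Variation.

(** * Choice of gamma and conclusion *)

Lemma harmonic_le_ln (R : realType) n :
  \sum_(i < n.+1) i.+1%:R^-1 <= 1 + ln n.+1%:R :> R.
Proof.
elim: n => [|n IH]; first by rewrite big_ord1 invr1 ln1 addr0.
rewrite big_ord_recr /=; apply: le_trans (lerD IH (lexx _)) _.
rewrite -addrA lerD2l addrC -lerBrDr.
have n1 : 0 < n.+1%:R :> R by []. have n2 : 0 < n.+2%:R :> R by [].
(* The inequality [ln (1 + x) <= x] at [x = - 1 / (n + 2)] yields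
   [1 / (n + 2) <= ln (n + 2) - ln (n + 1)]. *)
have E : n.+1%:R = n.+2%:R * (1 + - n.+2%:R^-1) :> R.
  by rewrite mulrDr mulr1 mulrN mulfV ?gt_eqF // -[n.+2%:R]natr1 addrK.
have pos : 0 < 1 + - n.+2%:R^-1 :> R by rewrite -(pmulr_rgt0 _ n2) -E.
have ltN1 : -1 < - n.+2%:R^-1 :> R by rewrite -subr_gt0 opprK addrC.
rewrite E lnM ?posrE // opprD addrA subrr add0r.
by rewrite lerNr; exact: le_ln1Dx.
Qed.

Theorem theorem1 (R : realType) (d : nat) (lam : nat -> R)
  (hd : (2 <= d)%N)
  (lam1_gt1 : 1 < lam 1%N)
  (lam_nondecr : forall n : nat, (1 <= n)%N -> lam n <= lam n.+1)
  (lam_pinfty : lam n @[n --> \oo] --> +oo)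
  (lam_ratio_nonincr : forall n : nat, (1 <= n)%N ->
     lam n.+1 / n.+1%:R <= lam n / n%:R)
  (lam_ratio_0 : (lam n / n%:R) @[n --> \oo] --> (0 : R))
  (lam_summable : (\sum_(1 <= n <oo)
     (lam n * (ln (n%:R : R)) ^+ (d - 2) / n%:R ^+ 2)%:E < +oo)%E) :
  exists gam : nat -> R,
    [/\ forall n : nat, (1 <= n)%N -> 0 < gam n,
        (gam : nat -> R^o) =o_\oo (fun n : nat => n%:R : R^o)
      & PBV d lam `<=` BV d gam].
Proof.
have lam0 n : 0 < lam n.+1.
  apply: lt_trans ltr01 _; elim: n => // n IH.
  exact: lt_le_trans IH (lam_nondecr _ _).
pose A n := lam n.+1 / n.+1%:R.
pose H n : R := \sum_(i < n.+1) i.+1%:R^-1.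
(* Harmonic sums replace logarithms: they arise from summing [1 / gam], and they keep [u] positive
   at the first index, where the logarithm vanishes. *)
pose u n := A n / n.+1%:R * H n ^+ (d - 2).
have A0 n : 0 < A n by rewrite divr_gt0.
have H1 n : 1 <= H n.
  by rewrite /H big_ord_recl invr1 lerDl sumr_ge0 // => i _; rewrite invr_ge0.
have u0 n : 0 < u n.
  by rewrite mulr_gt0 ?divr_gt0 // exprn_gt0 // (lt_le_trans ltr01).
have [B uB] : exists B, forall n, \sum_(k < n) u k <= B.
  pose c n := lam n * (ln (n%:R : R)) ^+ (d - 2) / n%:R ^+ 2.
  have c0 n : (1 <= n)%N -> 0 <= c n.
    case: n => // n _; rewrite divr_ge0 ?exprn_ge0 // mulr_ge0 ?(ltW (lam0 _)) //.
    by rewrite exprn_ge0 // ln_ge0 // ler1n.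
  pose S : \bar R := (\sum_(1 <= n <oo) (c n)%:E)%E.
  have cS n : (\sum_(1 <= k < n) (c k)%:E <= S)%E.
    by apply: nneseries_lim_ge => k k1 _; rewrite lee_fin c0.
  have Sfin : S \is a fin_num.
    rewrite ge0_fin_numE //; apply: le_trans (cS 1%N).
    by rewrite big_geq.
  have ln2 : 0 < ln 2 :> R by rewrite ln_gt0 // ltr1n.
  (* From index 2 on, [1 + ln n <= (1 + 1 / ln 2) * ln n]. The term [u 0], corresponding to
     [ln 1 = 0], is bounded separately. *)
  pose q : R := (1 + (ln 2)^-1) ^+ (d - 2).
  have uc n : u n.+1 <= q * c n.+2.
    rewrite /u /A /c -!mulrA [q * _]mulrCA ler_wpM2l ?(ltW (lam0 _)) //.
    rewrite mulrA -invfM -expr2 mulrC mulrA ler_wpM2r ?invr_ge0 ?exprn_ge0 //.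
    rewrite -exprMn lerXn2r ?nnegrE ?mulr_ge0 ?addr_ge0 ?invr_ge0 ?(ltW ln2) ?ln_ge0 ?ler1n //.
      exact: le_trans (H1 _).
    apply: le_trans (harmonic_le_ln R n.+1) _.
    rewrite mulrDl mul1r addrC lerD2l mulrC ler_pdivlMr // mul1r.
    by rewrite ler_ln ?posrE // ler_nat.
  have q0 : 0 <= q by rewrite exprn_ge0 // addr_ge0 // invr_ge0 ltW.
  exists (u 0%N + q * fine S) => n.
  have csum m : \sum_(k < m) c k.+2 <= fine S.
    rewrite -lee_fin fineK // -sumEFin; apply: le_trans (cS m.+2).
    rewrite big_nat_recl // -[leLHS]add0e leeD ?lee_fin ?c0 //.
    by rewrite (big_addn 0 _ 1) subn1 big_mkord; under [leRHS]eq_bigr do rewrite addn1.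
  case: n => [|n].
    rewrite big_ord0 addr_ge0 ?(ltW (u0 _)) // mulr_ge0 // fine_ge0 //.
    by rewrite (le_trans _ (cS 1%N)) // big_geq.
  rewrite big_ord_recl lerD2l (le_trans _ (ler_wpM2l q0 (csum n))) //.
  by rewrite mulr_sumr; apply: ler_sum => k _; exact: uc.
have d0 : (0 < d)%N by apply: leq_trans hd.
have Amono n : A n.+1 <= A n by exact: lam_ratio_nonincr.
have Acvg : A n @[n --> \oo] --> (0 : R).
  by rewrite -(cvg_shiftS (fun n => lam n / n%:R)) in lam_ratio_0.
have [om [om1 ommono om_infty Aom [K omK]]] := regular_weight d0 A0 Amono Acvg u0 uB.
have om0 n : 0 < om n by apply: lt_le_trans (om1 n).
(* [om] is indexed from 0 and [gam] from 1, hence the predecessor. *)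
pose gam n := n%:R / om n.-1.
have gam0 n : 0 < gam n.+1 by rewrite divr_gt0.
exists gam; split=> [[] //||f [fbase fPBV]].
  apply/eqoP => e e0; have [N Ne] := om_infty e^-1.
  exists N.+1 => // -[|n] //= Nn.
  rewrite ger0_norm ?(ltW (gam0 _)) // ger0_norm // /gam mulrC ler_wpM2r //.
  by rewrite -[e]invrK lef_pV2 ?posrE ?invr_gt0 // Ne.
split=> //; apply: lte_sum_pinfty => alpha alpha0.
have var_lty j : (Defs.variation lam [set j]%SET f < +oo)%E.
  apply: le_lt_trans fPBV; rewrite (bigD1 j) //= leeDl // sume_ge0 // => i _.
  exact: lambda_variation_ge0.
have var_fin j : Defs.variation lam [set j]%SET f \is a fin_num.
  by rewrite ge0_fin_numE // lambda_variation_ge0.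
pose C := \sum_j fine (Defs.variation lam [set j]%SET f).
have fine0 j : 0 <= fine (Defs.variation lam [set j]%SET f).
  by rewrite fine_ge0 // lambda_variation_ge0.
have C0 : 0 <= C by rewrite sumr_ge0.
have VC j : (Defs.variation lam [set j]%SET f <= C%:E)%E.
  rewrite -(fineK (var_fin j)) lee_fin.
  exact: (ler_sum_term (i := j) (P := predT)).
(* This is the ratio [lam n.+1 / gam n.+1]; its monotonicity is what [Aom] provides. *)
pose th n := A n * om n.
have th0 n : 0 <= th n by rewrite mulr_ge0 // ltW.
have thmono : {homo th : k n / (k <= n)%N >-> n <= k}.
  by apply/nonincreasing_seqP.
have thlam k n : (k <= n)%N -> lam n.+1 <= th k * gam n.+1.
  move=> kn; apply: le_trans (ler_wpM2r (ltW (gam0 n)) (thmono _ _ kn)).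
  rewrite /th /gam /A /= le_eqVlt; apply/orP; left; apply/eqP.
  by rewrite [RHS]mulrACA divfK ?gt_eqF // mulfV ?gt_eqF // mulr1.
have [alpha1|alpha2] := leqP #|alpha| 1.
  have /cards1P[j ->] : #|alpha| == 1%N by rewrite eqn_leq alpha1 card_gt0.
  apply: le_lt_trans (ltry (th 0%N ^+ #|[set j]%SET| * C)).
  by apply: lambda_variation_rescale (VC j) => // n; exact: thlam.
apply: le_lt_trans (ltry (#|alpha|%:R ^+ 2 * (2 ^+ #|alpha| * C * K))).
apply: (lambda_variation_bound (th := th)) => // n; apply: le_trans (omK n).
(* Two powers of [om k] come from [th k / gam k.+1], the others from the sums of [1 / gam]. *)
apply: ler_sum => k _; have -> : om k ^+ d = om k ^+ 2 * om k ^+ (d - 2) by rewrite -exprD subnKC.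
have sum_gam : \sum_(m < k.+1) (gam m.+1)^-1 <= om k * H k.
  rewrite mulr_sumr; apply: ler_sum => m _; rewrite invfM invrK mulrC.
  rewrite ler_wpM2r ?invr_ge0 //.
  by move/nondecreasing_seqP : ommono; apply; rewrite -ltnS ltn_ord.
have -> : th k / gam k.+1 = A k / k.+1%:R * om k ^+ 2.
  by rewrite /th /gam /= invfM invrK expr2 !mulrA; congr (_ * _); rewrite mulrAC.
have -> : u k * (om k ^+ 2 * om k ^+ (d - 2)) =
    A k / k.+1%:R * om k ^+ 2 * (om k * H k) ^+ (d - 2).
  by rewrite /u mulrACA exprMn [in RHS](mulrC (om k ^+ _)).
rewrite ler_wpM2l //.
  exact: mulr_ge0 (divr_ge0 (ltW (A0 _)) (ler0n _ _)) (exprn_ge0 _ (ltW (om0 _))).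
apply: le_trans (_ : (om k * H k) ^+ (#|alpha| - 2) <= _).
  rewrite lerXn2r ?nnegrE // ?sumr_ge0 // => [*|].
    by rewrite invr_ge0 ltW.
  by rewrite mulr_ge0 ?(ltW (om0 _)) // (le_trans _ (H1 _)).
(* As [om k * H k >= 1], the exponent may be raised from [#|alpha| - 2] to [d - 2]. *)
rewrite ler_weXn2l ?mulr_ege1 // leq_sub2r //.
by rewrite (leq_trans (max_card _)) // card_ord.
Qed.
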